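(* If a CLCD formula is satisfied in a finite pseudomodel, it is satisfied in a model.
   Context: Let $N$ be a finite set of agents and $\Theta$ a set of atomic propositions. CLCD-formulas: $\phi ::= p \mid \neg\phi \mid \phi\wedge\phi \mid [H]\phi \mid K_i\phi \mid C_G\phi \mid D_G\phi$ ($H\subseteq N$, $\emptyset\neq G\subseteq N$). An effectivity function $E$ on $S$ is truly playable if for all $s$: (E1) $\emptyset\notin E(G)(s)$; (E2) $S\in E(G)(s)$; (E3) $S\setminus X\notin E(\emptyset)(s)\Rightarrow X\in E(N)(s)$; (E4) if $X\subseteq Y$ and $X\in E(G)(s)$ then $Y\in E(G)(s)$; (E5) $X\in E(G_1)(s)$, $Y\in E(G_2)(s)$, $G_1\cap G_2=\emptyset$ imply $X\cap Y\in E(G_1\cup G_2)(s)$; (E6) the set of $\subseteq$-minimal elements of $E(\emptyset)(s)$ is non-empty. A model is $\langle S,E,\sim_1,\ldots,\sim_n,V\rangle$ with $S$ non-empty, $V$ a valuation, $\sim_i$ equivalence relations and $E$ truly playable; there $D_G\phi$ holds at $s$ iff $\phi$ holds at every $t$ with $(s,t)\in\bigcap_{i\in G}\sim_i$. A pseudomodel is $(S,\{\sim_i\},\{R_G:\emptyset\neq G\subseteq N\},E,V)$ where $(S,E,\{\sim_i\},V)$ is a model, each $R_G$ is an equivalence relation, $R_{\{i\}}=\sim_i$, and $G\subseteq H\Rightarrow R_H\subseteq R_G$; in a pseudomodel $D_G\phi$ is instead interpreted via $R_G$. In both, $[G]\phi$ holds at $s$ iff $\{t:\phi\text{ true at }t\}\in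 E(G)(s)$, $K_i\phi$ is interpreted via $\sim_i$, and $C_G\phi$ holds at $s$ iff $\phi$ holds at every $t$ reachable via $(\bigcup_{i\in G}\sim_i)^*$. *)

(* Defs.v *)
From Stdlib Require Import Relation_Definitions Relation_Operators.
From mathcomp Require Import all_boot.
From mathcomp Require Import boolp classical_sets cardinality.

Set Implicit Arguments.
Unset Strict Implicit.
Unset Printing Implicit Defensive.

Local Open Scope classical_set_scope.

Section CLCD.

Variables (N : finType) (Theta : Type).

(* Coalitions are finsets of agents, whereas sets of states are classical sets:
   unqualified set0, setT and [set x | P] below are the classical ones. *)
Definition coalition : Type := {set N}.

Definition necoalition : Type := {G : coalition | G != finset.set0}.

Fact coalition1_neq0 (i : N) : finset.set1 i != finset.set0.
Proof. by apply/set0Pn; exists i; rewrite finset.inE. Qed.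

Definition necoalition1 (i : N) : necoalition :=
  exist (fun G : coalition => G != finset.set0)
        (finset.set1 i) (coalition1_neq0 i).

Inductive formula : Type :=
| Atom (p : Theta)
| Neg (phi : formula)
| And (phi psi : formula)
| Can (H : coalition) (phi : formula)
| Know (i : N) (phi : formula)
| Common (G : necoalition) (phi : formula)
| Distr (G : necoalition) (phi : formula).

Definition effectivity (S : Type) : Type := coalition -> S -> set (set S).

Definition minimal_elements (S : Type) (F : set (set S)) : set (set S) :=
  [set X | F X /\ forall Y, F Y -> ~ Y `<` X].

Record truly_playable (S : Type) (E : effectivity S) : Prop := {
  tp_E1 : forall s G, ~ E G s set0;
  tp_E2 : forall s G, E G s setT;
  tp_E3 : forall s X, ~ E finset.set0 s (~` X) -> E finset.setT s X;
  tp_E4 : forall s G X Y, X `<=` Y -> E G s X -> E G s Y;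
  tp_E5 : forall s (G1 G2 : coalition) X Y,
    E G1 s X -> E G2 s Y -> finset.setI G1 G2 = finset.set0 ->
    E (finset.setU G1 G2) s (X `&` Y);
  tp_E6 : forall s, minimal_elements (E finset.set0 s) !=set0
}.

Record model : Type := Model {
  state :> Type;
  eff : effectivity state;
  sim : N -> relation state;
  val_atom : Theta -> set state;
  state_inhabited : inhabited state;
  sim_equiv : forall i, equivalence state (sim i);
  eff_playable : truly_playable eff
}.

Record pseudomodel : Type := Pseudomodel {
  pmodel :> model;
  prel : necoalition -> relation pmodel;
  prel_equiv : forall G, equivalence pmodel (prel G);
  prel1 : forall i s t, prel (necoalition1 i) s t <-> @sim pmodel i s t;
  prel_mono : forall G H : necoalition, val G \subset val H ->
    forall s t, prel H s t -> prel G s t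
}.

(* RD interprets D_G; this is the only clause on which the semantics in models
   and in pseudomodels differ. *)
Fixpoint truth (M : model) (RD : necoalition -> relation M) (phi : formula)
    (s : M) : Prop :=
  match phi with
  | Atom p => @val_atom M p s
  | Neg psi => ~ truth RD psi s
  | And psi chi => truth RD psi s /\ truth RD chi s
  | Can H psi => @eff M H s [set t | truth RD psi t]
  | Know i psi => forall t, @sim M i s t -> truth RD psi t
  | Common G psi => forall t,
      clos_refl_trans M
        (fun u v => exists2 i, i \in val G & @sim M i u v) s t ->
      truth RD psi t
  | Distr G psi => forall t, RD G s t -> truth RD psi t
  end.

Definition model_truth (M : model) : formula -> M -> Prop :=
  @truth M (fun G s t => forall i, i \in val G -> @sim M i s t).

Definition pseudo_truth (M : pseudomodel) : formula -> M -> Prop :=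
  @truth M (@prel M).

Definition finite_pseudomodel (M : pseudomodel) : Prop :=
  finite_set [set: M].

End CLCD.

(* Main.v *)
Require Import Defs.
From Stdlib Require Import Relation_Definitions Relation_Operators.
From mathcomp Require Import all_boot.
From mathcomp Require Import boolp classical_sets.

(** Let [s0] be a state of a pseudomodel [M].  The states of the model are the
    families [x] of surjections [x B : M -> M], indexed by the sets [B] of
    agents; [x] stands for the state [x set0 s0] of [M].  Agent [i] cannot
    distinguish [x] from [y] if [y B = d B \o x B] for some family [d] (and
    symmetrically) with [d B = d (i |: B)] such that [d B] moves every state
    within its [R_B]-class.  As the [x B] are surjective, [d] is determined by
    [x] and [y]; if all agents of [G] confuse [x] and [y], it follows that
    [d set0 = d G], so the states of [M] for which [x] and [y] stand are related
    by [R_G].  Conversely, an [R_G]-step from [s] to [t] is realised by letting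
    [d B] be the transposition of [s] and [t] for [B] included in [G], and the
    identity otherwise.

    Effectivity is pulled back along [x |-> x set0 s0], except that the grand
    coalition gets the dual of the empty one, as (E3) demands. *)

Set Implicit Arguments.
Unset Strict Implicit.
Unset Printing Implicit Defensive.

Local Open Scope classical_set_scope.

(** * Effectivity pulled back along a surjection *)

Section Pullback.

Variables (N : finType) (S T : Type) (f : T -> S) (E : effectivity N S).
Hypothesis f_surj : forall s, exists x, f x = s.

(** The image clause is the dual of the preimage clause: [f @^-1] Y[avoids]X[iff]Y[avoids]f @[X]. *)
Definition pullback_eff : effectivity N T := fun G x X =>
  if G == finset.setT then E G (f x) (f @` X)
  else exists2 Y, E G (f x) Y & f @^-1` Y `<=` X.

Lemma image_preimage_surj (Y : set S) : f @` (f @^-1` Y) = Y.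
Proof.
apply/seteqP; split=> [_ [x Yx <-] //|s Ys].
by have [x fx] := f_surj s; exists x => //; rewrite /preimage /= fx.
Qed.

Lemma preimage_subset_surj (Y Z : set S) : f @^-1` Y `<=` f @^-1` Z -> Y `<=` Z.
Proof. by move=> YZ s; have [x <-] := f_surj s; apply: YZ. Qed.

Hypothesis E_playable : truly_playable E.

Lemma pullback_eff_preimage G x Y :
  pullback_eff G x (f @^-1` Y) <-> E G (f x) Y.
Proof.
rewrite /pullback_eff; case: eqP => _; first by rewrite image_preimage_surj.
split=> [[Z EZ /preimage_subset_surj ZY]|EY]; last by exists Y.
exact: tp_E4 E_playable _ _ _ _ ZY EZ.
Qed.

Lemma pullback_eff_image G x X : pullback_eff G x X -> E G (f x) (f @` X).
Proof.
rewrite /pullback_eff; case: eqP => // _ [Y EY YX].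
apply: (tp_E4 E_playable _ EY); rewrite -(image_preimage_surj Y).
exact: image_subset.
Qed.

Hypothesis N_neq0 : finset.set0 != finset.setT :> {set N}.

Lemma pullback_eff0 x X :
  pullback_eff finset.set0 x X <->
  exists2 Y, E finset.set0 (f x) Y & f @^-1` Y `<=` X.
Proof. by rewrite /pullback_eff (negbTE N_neq0). Qed.

(** Only the empty coalition is disjoint from the grand one, so this is (E5) when one of the two
    coalitions is grand. Images do not commute with intersections, but a point of [X'] lying over
    [Y] is already in [X]. *)
Lemma pullback_eff0I x X X' :
  pullback_eff finset.set0 x X -> pullback_eff finset.setT x X' ->
  pullback_eff finset.setT x (X `&` X').
Proof.
move=> /pullback_eff0[Y EY YX]; rewrite /pullback_eff eqxx => EX'.
have := tp_E5 E_playable EY EX' (finset.set0I _); rewrite finset.set0U.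
apply: (tp_E4 E_playable) => s [Ys [x' X'x' fx']]; exists x' => //.
by split=> //; apply: YX; rewrite /preimage /= fx'.
Qed.

Lemma pullback_eff_playable : truly_playable pullback_eff.
Proof.
split.
- by move=> x G /pullback_eff_image; rewrite image_set0 => /(tp_E1 E_playable).
- by move=> x G; rewrite -(preimage_setT f) pullback_eff_preimage; exact: tp_E2.
- move=> x X nX; rewrite /pullback_eff eqxx; apply: (tp_E3 E_playable) => EX.
  apply: nX; apply/pullback_eff0; exists (~` (f @` X)) => // x' nx' Xx'.
  by apply: nx'; exists x'.
- move=> x G X X' XX'; rewrite /pullback_eff; case: eqP => _.
    by apply: tp_E4 => //; exact: image_subset.
  by case=> Y EY YX; exists Y => //; exact: subset_trans XX'.
- move=> x G1 G2 X1 X2 EX1 EX2 G12.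
  have [G1T|G1T] := eqVneq G1 finset.setT.
    move: G12 EX1 EX2; rewrite {}G1T finset.setTI => -> EX1 EX2.
    by rewrite finset.setU0 setIC; exact: pullback_eff0I.
  have [G2T|G2T] := eqVneq G2 finset.setT.
    move: G12 EX1 EX2; rewrite {}G2T finset.setIT => -> EX1 EX2.
    by rewrite finset.set0U; exact: pullback_eff0I.
  move: EX1 EX2; rewrite /pullback_eff (negbTE G1T) (negbTE G2T).
  move=> [Y1 EY1 YX1] [Y2 EY2 YX2].
  have EY := tp_E5 E_playable EY1 EY2 G12.
  have YX : f @^-1` (Y1 `&` Y2) `<=` X1 `&` X2.
    by rewrite preimage_setI; exact: setISS.
  (* Two proper coalitions may still unite to the grand one, which calls for the image clause. *)
  case: eqP => _; last by exists (Y1 `&` Y2).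
  apply: (tp_E4 E_playable _ EY); rewrite -(image_preimage_surj (Y1 `&` Y2)).
  exact: image_subset.
- move=> x; have [X [EX Xmin]] := tp_E6 E_playable (f x).
  exists (f @^-1` X); split; first exact/pullback_eff_preimage.
  move=> X' /pullback_eff0[Y EY YX'] [X'X nXX']; apply: (Xmin Y EY); split.
    by apply: preimage_subset_surj; exact: subset_trans X'X.
  by move=> XY; apply: nXX' => x' Xx'; apply: YX'; exact: XY.
Qed.

End Pullback.

(** * Bounded morphisms and invariance of truth *)

Section BoundedRelation.

Variables (S T : Type) (f : T -> S).

Definition bounded (R : relation S) (R' : relation T) :=
  (forall x y, R' x y -> R (f x) (f y)) /\
  (forall x t, R (f x) t -> exists2 y, R' x y & f y = t).

Lemma bounded_box (R : relation S) (R' : relation T) (P : S -> Prop) x :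
  bounded R R' ->
  (forall y, R' x y -> P (f y)) <-> (forall t, R (f x) t -> P t).
Proof.
by move=> [forth back]; split=> [H t /back[y /H Py <-]|H y /forth/H].
Qed.

Lemma bounded_clos_refl_trans (I : Type) (A : I -> Prop)
    (R : I -> relation S) (R' : I -> relation T) :
  (forall i, bounded (R i) (R' i)) ->
  bounded (clos_refl_trans S (fun u v => exists2 i, A i & R i u v))
          (clos_refl_trans T (fun u v => exists2 i, A i & R' i u v)).
Proof.
move=> RR'; split.
  move=> x y; elim=> {x y} [x y [i Ai xy]|x|x y z _ xy _ yz].
  - by apply: rt_step; exists i => //; case: (RR' i) => forth _; exact: forth.
  - exact: rt_refl.
  - exact: rt_trans yz.
move=> x t; move E: (f x) => s st.
elim: st x E => {s t} [s t [i Ai st]|s|s t u _ IHst _ IHtu] x E.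
- case: (RR' i) => _ back; rewrite -E in st; have [y xy fy] := back _ _ st.
  by exists y => //; apply: rt_step; exists i.
- by exists x => //; exact: rt_refl.
- have [y xy fy] := IHst _ E; have [z yz fz] := IHtu _ fy.
  by exists z => //; exact: rt_trans yz.
Qed.

End BoundedRelation.

Section BoundedMorphism.

Variables (N : finType) (Theta : Type) (M M' : model N Theta) (f : M' -> M).
Variables (RD : necoalition N -> relation M).
Variables (RD' : necoalition N -> relation M').

Hypothesis f_atom : forall p x, val_atom p x <-> val_atom p (f x).
Hypothesis f_eff : forall G x Y, eff G x (f @^-1` Y) <-> eff G (f x) Y.
Hypothesis f_sim : forall i, bounded f (@sim _ _ M i) (@sim _ _ M' i).
Hypothesis f_RD : forall G, bounded f (RD G) (RD' G).

Lemma truth_bounded_morphism phi x : truth RD' phi x <-> truth RD phi (f x).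
Proof.
elim: phi x => [p|phi IH|phi IH1 psi IH2|H phi IH|i phi IH|G phi IH|G phi IH] x /=.
- exact: f_atom.
- by rewrite IH.
- by rewrite IH1 IH2.
(* By induction the truth set upstairs is a preimage, the only kind of set that [f_eff] covers. *)
- rewrite -f_eff; have /funext-> : truth RD' phi =1 truth RD phi \o f.
    by move=> y; apply/propext; exact: IH.
  by [].
- by rewrite -(bounded_box _ _ (f_sim i)); split=> H y /H /IH.
- rewrite -(bounded_box _ _ (bounded_clos_refl_trans _ f_sim)).
  by split=> H y /H /IH.
- by rewrite -(bounded_box _ _ (f_RD G)); split=> H y /H /IH.
Qed.

End BoundedMorphism.

Section Transposition.

Variables (S : Type).

Definition transp (s t u : S) : S :=
  if `[< u = s >] then t else if `[< u = t >] then s else u.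

Lemma transpL s t : transp s t s = t.
Proof. by rewrite /transp asboolT. Qed.

Lemma transpK s t : involutive (transp s t).
Proof.
move=> u; rewrite /transp.
case: (asboolP (u = s)) => [->|us].
  by case: (asboolP (t = s)) => // _; rewrite asboolT.
case: (asboolP (u = t)) => [->|ut]; first by rewrite asboolT.
by rewrite !asboolF.
Qed.

Lemma transp_equiv (R : relation S) s t u :
  equivalence S R -> R s t -> R u (transp s t u).
Proof.
move=> [Rr _ Rs] Rst; rewrite /transp.
case: asboolP => [-> //|_]; case: asboolP => [->|_]; [exact: Rs|exact: Rr].
Qed.

End Transposition.

(** * The covering model *)

Section Cover.

Variables (N : finType) (Theta : Type) (M : pseudomodel N Theta) (s0 : M).

Definition cover : Type :=
  {x : {set N} -> M -> M | forall B t, exists s, x B s = t}.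

Definition proj (x : cover) : M := sval x finset.set0 s0.

(** There is no relation for the empty coalition, so the last clause leaves [d set0] free; the
    second one equates it with [d] at the singleton of [i]. *)
Definition moves (i : N) (d : {set N} -> M -> M) (x y : cover) : Prop :=
  [/\ forall B s, sval y B s = d B (sval x B s),
      forall B, d B = d (i |: B)%SET
    & forall (G : necoalition N) s, prel G s (d (val G) s)].

(** Both directions are required because [d B] need not be injective. *)
Definition cover_sim (i : N) (x y : cover) : Prop :=
  (exists d, moves i d x y) /\ (exists d, moves i d y x).

Lemma moves_refl i x : moves i (fun _ => id) x x.
Proof. by split=> // G s; case: (prel_equiv M G) => + _ _; apply. Qed.

Lemma moves_trans i d e x y z :
  moves i d x y -> moves i e y z -> moves i (fun B => e B \o d B) x z.
Proof.
move=> [yx di dR] [zy ei eR]; split=> [B s|B|G s].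
- by rewrite zy yx.
- by rewrite -di -ei.
- by case: (prel_equiv M G) => _ tr _; exact: tr (eR _ _).
Qed.

Lemma cover_sim_equiv i : equivalence cover (cover_sim i).
Proof.
split.
- by move=> x; split; exists (fun _ => id); exact: moves_refl.
- move=> x y z [[d xy] [d' yx]] [[e yz] [e' zy]].
  by split; eexists; [exact: moves_trans xy yz|exact: moves_trans zy yx].
- by move=> x y [].
Qed.

(** Allowing [i] and [j] to differ lets a single [d] inherit the invariance of every agent in a
    group. *)
Lemma moves_uniq i j d e x y : moves i d x y -> moves j e x y -> d = e.
Proof.
move=> [yd _ _] [ye _ _]; apply/funext => B; apply/funext => t.
by have [s <-] := svalP x B t; rewrite -yd -ye.
Qed.

Lemma cover_sim_forth (G : necoalition N) (x y : cover) :
  (forall i, i \in val G -> cover_sim i x y) -> prel G (proj x) (proj y).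
Proof.
move=> Gxy; have [i0 i0G] := set0Pn _ (valP G).
have [[d dxy] _] := Gxy _ i0G; have [yx _ dR] := dxy.
have dU i B : i \in val G -> d B = d (i |: B)%SET.
  move=> /Gxy[[e exy] _]; rewrite (moves_uniq dxy exy).
  by case: exy.
rewrite /proj yx; suff -> : d finset.set0 = d (val G) by exact: dR.
(* The agents of [G] are added to the empty set one at a time, none of them changing [d]. *)
have -> : val G = (\bigcup_(i in val G) finset.set1 i)%SET.
  apply/finset.setP => i; apply/idP/finset.bigcupP => [iG|[j jG]].
    by exists i; rewrite ?finset.set11.
  by rewrite finset.inE => /eqP->.
by elim/big_rec: _ => // i B iG ->; exact: dU.
Qed.

Lemma cover_sim_back (G : necoalition N) (x : cover) t :
  prel G (proj x) t ->
  exists2 y, (forall i, i \in val G -> cover_sim i x y) & proj y = t.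
Proof.
move=> Gst.
pose d (B : {set N}) := if B \subset val G then transp (proj x) t else id.
(* This gives surjectivity below, and lets the same [d] lead back from [y] to [x]. *)
have dK B : involutive (d B) by rewrite /d; case: ifP => // _; exact: transpK.
have d_surj B u : exists s, d B (sval x B s) = u.
  by have [s xs] := svalP x B (d B u); exists s; rewrite xs dK.
have di i B : i \in val G -> d B = d (i |: B)%SET.
  by move=> iG; rewrite /d finset.subUset finset.sub1set iG.
have dR (H : necoalition N) s : prel H s (d (val H) s).
  rewrite /d; case: ifP => [HG|_]; last by case: (prel_equiv M H) => + _ _; apply.
  by apply: transp_equiv (prel_equiv M H) _; exact: prel_mono Gst.
pose y : cover := exist _ (fun B => d B \o sval x B) d_surj.
exists y; last by rewrite /proj /= /d finset.sub0set transpL.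
by move=> i iG; split; exists d; split=> *; rewrite /= ?dK -?di.
Qed.

Lemma bounded_cover_sim i : bounded proj (@sim _ _ M i) (cover_sim i).
Proof.
split=> [x y xy|x t /prel1/cover_sim_back[y xy <-]].
  by apply/prel1/cover_sim_forth => j; rewrite /= finset.inE => /eqP->.
by exists y => //; apply: xy; rewrite /= finset.inE.
Qed.

Lemma bounded_cover_sim_all (G : necoalition N) :
  bounded proj (@prel _ _ M G)
    (fun x y => forall i, i \in val G -> cover_sim i x y).
Proof. by split=> [x y|x t]; [exact: cover_sim_forth|exact: cover_sim_back]. Qed.

Lemma proj_surj t : exists x, proj x = t.
Proof.
(* States of the cover need not respect any [prel], so a constant family of transpositions reaches
   every [t]. *)
have x_surj (B : {set N}) u : exists s, transp s0 t s = u.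
  by exists (transp s0 t u); rewrite transpK.
by exists (exist _ (fun _ => transp s0 t) x_surj); rewrite /proj /= transpL.
Qed.

Hypothesis N_neq0 : finset.set0 != finset.setT :> {set N}.

Definition cover_model : model N Theta := {|
  eff := pullback_eff proj (@eff _ _ M);
  sim := cover_sim;
  val_atom := fun p => proj @^-1` val_atom p;
  state_inhabited := let: ex_intro x _ := proj_surj s0 in inhabits x;
  sim_equiv := cover_sim_equiv;
  eff_playable := pullback_eff_playable proj_surj (@eff_playable _ _ M) N_neq0
|}.

Lemma cover_model_truth phi (x : cover_model) :
  model_truth phi x <-> pseudo_truth phi (proj x).
Proof.
apply: (@truth_bounded_morphism _ _ M cover_model proj) => //.
- exact: pullback_eff_preimage proj_surj (@eff_playable _ _ M).
- exact: bounded_cover_sim.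
- exact: bounded_cover_sim_all.
Qed.

End Cover.

Theorem theorem5 (N : finType) (Theta : Type) (phi : formula N Theta) :
  (exists M : pseudomodel N Theta,
     finite_pseudomodel M /\ exists s : M, pseudo_truth phi s) ->
  exists (M : model N Theta) (s : M), model_truth phi s.
Proof.
move=> [M [_ [s phi_s]]].
have [N0|N_neq0] := eqVneq (finset.set0 : {set N}) finset.setT.
  (* Without agents there is no D_G to interpret, and (E3) forbids the pullback
     of effectivity, as the empty coalition is the grand one. *)
  exists M, s; rewrite /model_truth.
  set RD := (RD in truth RD); suff -> : RD = @prel _ _ M by [].
  apply/funext => G; have /set0Pn[i] := valP G.
  by have := finset.in_setT i; rewrite -N0 finset.inE.
have [x xs] := proj_surj s s.
by exists (cover_model s N_neq0), x; apply/cover_model_truth; rewrite xs.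
Qed.
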